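(* For $d\ge0$ let $S_2^d=(1,\sigma_1,\sigma_1^2,\dots,\sigma_1^d)$, and define finite sequences of positive $3$-braids $S_3^d$ inductively on $d\ge0$ by $$S_3^d=\delta_{3,0}S_2^d+S_3^{d,1}+\delta_{3,1}S_2^d+S_3^{d,2}+\delta_{3,2}S_2^d+\cdots+\delta_{3,2d-1}S_2^d+S_3^{d,2d}+\delta_{3,2d}S_2^d$$ (so $S_3^0=\delta_{3,0}S_2^0=(1)$), where, for $d\ge1$, $S_3^{d,1}=S_3^{d,2d}=\emptyset$ (empty sequence) and, for $2\le p\le 2d-1$, $$S_3^{d,p}=\begin{cases} \sigma_1\,(S_3^{d-1,p-1}+\delta_{3,p-1}S_2^{d-1}+S_3^{d-1,p}) & \text{if } p\equiv0 \pmod 4,\\ \sigma_2\sigma_1\,(S_3^{d-1,p-2}+\delta_{3,p-2}S_2^{d-1}+S_3^{d-1,p-1}) & \text{if } p\equiv1 \pmod 4,\\ \sigma_2\,(S_3^{d-1,p-1}+\delta_{3,p-1}S_2^{d-1}+S_3^{d-1,p}) & \text{if } p\equiv2 \pmod 4,\\ \sigma_1\sigma_2\,(S_3^{d-1,p-2}+\delta_{3,p-2}S_2^{d-1}+S_3^{d-1,p-1}) & \text{if } p\equiv3 \pmod 4. \end{cases}$$ Then, for every $d\ge0$, $S_3^d$ is the $<$-increasing enumeration of $\mathrm{Div}(\Delta_3^d)$.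
   Context: Braids. $B_3=\langle\sigma_1,\sigma_2;\ \sigma_1\sigma_2\sigma_1=\sigma_2\sigma_1\sigma_2\rangle$ is the $3$-strand braid group, and $B_3^+$ is the monoid with the same presentation, which embeds in $B_3$; its elements are the positive $3$-braids. $\Delta_3=\sigma_1\sigma_2\sigma_1$. $\mathrm{Div}(y)$ is the set of all $x\in B_3^+$ with $y=xt$ for some $t\in B_3^+$. Ordering. The main generator of a nonempty word in $\sigma_1^{\pm1},\sigma_2^{\pm1}$ is $\sigma_m$ where $m$ is the largest index such that $\sigma_m$ or $\sigma_m^{-1}$ occurs; the word is $\sigma$-positive if its main generator $\sigma_m$ occurs but $\sigma_m^{-1}$ does not. For $x,y\in B_3$, $x<y$ means that $x^{-1}y$ has a $\sigma$-positive expression. It is known that a $\sigma$-positive word never represents $1$, so that $<$ is a strict (in fact linear) order. Notation. For $p\ge0$, $\delta_{3,p}$ is the braid represented by the length $p$ suffix of the left-infinite word $\cdots(\sigma_2\sigma_1\sigma_1\sigma_2)(\sigma_2\sigma_1\sigma_1\sigma_2)$; thus $\delta_{3,0}=1$, $\delta_{3,1}=\sigma_2$, $\delta_{3,2}=\sigma_1\sigma_2$, $\delta_{3,3}=\sigma_1\sigma_1\sigma_2$, $\delta_{3,4}=\sigma_2\sigma_1\sigma_1\sigma_2$, etc. For sequences $S,S'$ of braids, $S+S'$ is their concatenation ($S$ followed by $S'$); for a braid $x$, $xS$ is the sequence obtained by multiplying every entry of $S$ by $x$ on the left (and $x\emptyset=\emptyset$). *)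

(* Defs.v *)
From HB Require Import structures.
From mathcomp Require Import all_boot.
From mathcomp Require Import generic_quotient.
From mathcomp.classical Require Import boolp.

Set Implicit Arguments.
Unset Strict Implicit.
Unset Printing Implicit Defensive.

Local Open Scope group_scope.
Local Open Scope quotient_scope.

Section PresentedMonoid.

Variables (A : choiceType) (rel : seq A -> seq A -> Prop).

Inductive congruence : seq A -> seq A -> Prop :=
| congr_rel u v : rel u v -> congruence u v
| congr_refl u : congruence u u
| congr_sym u v : congruence u v -> congruence v u
| congr_trans u v w : congruence u v -> congruence v w -> congruence u w
| congr_cat u u' v v' :
    congruence u u' -> congruence v v' -> congruence (u ++ v) (u' ++ v').

Definition congruenceb (u v : seq A) : bool := `[< congruence u v >].

Fact congruenceb_refl : reflexive congruenceb.
Proof. by move=> u; apply/asboolP; exact: congr_refl. Qed.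

Fact congruenceb_sym : symmetric congruenceb.
Proof. by move=> u v; apply/asboolP/asboolP; exact: congr_sym. Qed.

Fact congruenceb_trans : transitive congruenceb.
Proof.
by move=> v u w /asboolP uv /asboolP vw; apply/asboolP; exact: congr_trans uv vw.
Qed.

Canonical congruence_equiv :=
  EquivRel congruenceb congruenceb_refl congruenceb_sym congruenceb_trans.

Definition presented : Type := {eq_quot congruence_equiv}.
HB.instance Definition _ := Choice.on presented.

Definition class_of (u : seq A) : presented := \pi_{eq_quot congruence_equiv} u.

Definition word_of (x : presented) : seq A :=
  repr (x : {eq_quot congruence_equiv}).

Lemma word_ofK : cancel word_of class_of.
Proof. exact: reprK. Qed.

Lemma class_ofP u v : class_of u = class_of v <-> congruence u v.
Proof.
split=> [/eqmodP/asboolP //|uv]; by apply/eqmodP/asboolP.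
Qed.

Lemma class_of_word u : congruence (word_of (class_of u)) u.
Proof. by apply/class_ofP; rewrite word_ofK. Qed.

Definition presented_mul (x y : presented) : presented :=
  class_of (word_of x ++ word_of y).

Lemma class_of_cat u v : class_of (u ++ v) = presented_mul (class_of u) (class_of v).
Proof.
by apply/class_ofP/congr_sym/congr_cat; exact: class_of_word.
Qed.

Fact presented_mulA : associative presented_mul.
Proof.
move=> x y z; rewrite -(word_ofK x) -(word_ofK y) -(word_ofK z).
by rewrite -!class_of_cat catA.
Qed.

Fact presented_mul1 : left_id (class_of [::]) presented_mul.
Proof. by move=> x; rewrite -(word_ofK x) -class_of_cat. Qed.

Fact presented_mulr1 : right_id (class_of [::]) presented_mul.
Proof. by move=> x; rewrite -(word_ofK x) -class_of_cat cats0. Qed.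

HB.instance Definition _ :=
  isMonoid.Build presented presented_mulA presented_mul1 presented_mulr1.

Lemma class_of_nil : class_of [::] = 1.
Proof. by []. Qed.

Lemma class_ofM u v : class_of (u ++ v) = class_of u * class_of v.
Proof. exact: class_of_cat. Qed.

End PresentedMonoid.

(* The generator sigma_(i+1) is encoded by i : 'I_2. *)
Notation s1 := (ord0 : 'I_2).
Notation s2 := (ord_max : 'I_2).

Variant braid_rel : seq 'I_2 -> seq 'I_2 -> Prop :=
| BraidRel : braid_rel [:: s1; s2; s1] [:: s2; s1; s2].

Definition B3plus : Type := presented braid_rel.
HB.instance Definition _ := Monoid.on B3plus.

(* The letter (i, true) is sigma_(i+1) and (i, false) is its inverse. *)
Definition signed_letter : choiceType := ('I_2 * bool)%type.

Definition pos_word (u : seq 'I_2) : seq signed_letter := [seq (i, true) | i <- u].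

(* The group presentation of B_3, read as a monoid presentation on the signed
   letters: the braid relation together with free cancellation. *)
Variant signed_rel : seq signed_letter -> seq signed_letter -> Prop :=
| SignedBraidRel u v : braid_rel u v -> signed_rel (pos_word u) (pos_word v)
| CancelRel i b : signed_rel [:: (i, b); (i, ~~ b)] [::].

Definition B3 : Type := presented signed_rel.
HB.instance Definition _ := Monoid.on B3.

Definition inv_word (w : seq signed_letter) : seq signed_letter :=
  rev [seq (a.1, ~~ a.2) | a <- w].

Lemma inv_word_cat u v : inv_word (u ++ v) = inv_word v ++ inv_word u.
Proof. by rewrite /inv_word map_cat rev_cat. Qed.

Lemma inv_wordK : involutive inv_word.
Proof.
move=> w; rewrite /inv_word map_rev revK -map_comp -[RHS]map_id.
by apply: eq_map => -[i b] /=; rewrite negbK.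
Qed.

Lemma cat_inv_word w : congruence signed_rel (w ++ inv_word w) [::].
Proof.
elim: w => [|[i b] w IHw]; first exact: congr_refl.
rewrite -cat1s inv_word_cat -catA (catA w).
apply: congr_trans (congr_rel (CancelRel i b)).
apply: congr_cat (congr_refl _ _) _.
rewrite -[X in congruence _ _ X]cat0s.
exact: congr_cat IHw (congr_refl _ _).
Qed.

Lemma inv_word_cat_word w : congruence signed_rel (inv_word w ++ w) [::].
Proof. by rewrite -{2}(inv_wordK w); exact: cat_inv_word. Qed.

Lemma congr_inv_word u v :
  congruence signed_rel u v -> congruence signed_rel (inv_word u) (inv_word v).
Proof.
move=> uv; have H1 : congruence signed_rel (inv_word u ++ u ++ inv_word v)
    (inv_word v).
  rewrite catA -[X in congruence _ _ X]cat0s.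
  exact: congr_cat (inv_word_cat_word u) (congr_refl _ _).
apply: congr_trans H1; rewrite -[X in congruence _ X _]cats0.
apply: congr_cat (congr_refl _ _) (congr_sym _).
apply: congr_trans (cat_inv_word v).
exact: congr_cat uv (congr_refl _ _).
Qed.

Definition B3_inv (x : B3) : B3 := class_of signed_rel (inv_word (word_of x)).

Fact B3_mulVg : left_inverse 1 B3_inv (@mul B3).
Proof.
move=> x; rewrite -{2}(word_ofK x) -[LHS]class_ofM.
by apply/class_ofP; exact: inv_word_cat_word.
Qed.

Fact B3_mulgV : right_inverse 1 B3_inv (@mul B3).
Proof.
move=> x; rewrite -{1}(word_ofK x) -[LHS]class_ofM.
by apply/class_ofP; exact: cat_inv_word.
Qed.

HB.instance Definition _ := hasInv.Build B3 B3_inv.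
HB.instance Definition _ := Monoid_isGroup.Build B3 B3_mulVg B3_mulgV.

Definition braid (w : seq signed_letter) : B3 := class_of signed_rel w.
Definition pbraid (u : seq 'I_2) : B3plus := class_of braid_rel u.

(* The canonical map from B_3^+ to B_3. *)
Definition to_B3 (x : B3plus) : B3 := braid (pos_word (word_of x)).

Lemma congr_pos_word u v :
  congruence braid_rel u v -> congruence signed_rel (pos_word u) (pos_word v).
Proof.
elim=> {u v} [u v uv|u|u v _|u v w _ uv _ vw|u u' v v' _ uu' _ vv'].
- exact/congr_rel/SignedBraidRel.
- exact: congr_refl.
- exact: congr_sym.
- exact: congr_trans uv vw.
- by rewrite /pos_word !map_cat; exact: congr_cat.
Qed.

Lemma to_B3_pbraid u : to_B3 (pbraid u) = braid (pos_word u).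
Proof. by apply/class_ofP/congr_pos_word; exact: class_of_word. Qed.

Lemma braidM u v : braid (u ++ v) = braid u * braid v.
Proof. exact: class_ofM. Qed.

Lemma pbraidM u v : pbraid (u ++ v) = pbraid u * pbraid v.
Proof. exact: class_ofM. Qed.

Lemma to_B3M x y : to_B3 (x * y) = to_B3 x * to_B3 y.
Proof.
rewrite -(word_ofK x) -(word_ofK y) -[class_of _ _ * _]pbraidM !to_B3_pbraid.
by rewrite -braidM /pos_word map_cat.
Qed.

Definition main_generator (w : seq signed_letter) (m : 'I_2) : Prop :=
  (exists b, (m, b) \in w) /\ (forall a, a \in w -> (a.1 <= m)%N).

Definition sigma_positive (w : seq signed_letter) : Prop :=
  exists m : 'I_2,
    [/\ main_generator w m, (m, true) \in w & (m, false) \notin w].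

Definition B3_lt (x y : B3) : Prop :=
  exists2 w, sigma_positive w & x^-1 * y = braid w.

Definition Bp_lt (x y : B3plus) : Prop := B3_lt (to_B3 x) (to_B3 y).

Definition Div (y : B3plus) (x : B3plus) : Prop := exists t, y = x * t.

Definition sigma1 : B3plus := pbraid [:: s1].
Definition sigma2 : B3plus := pbraid [:: s2].

Definition Delta3 : B3plus := sigma1 * sigma2 * sigma1.

(* [nseq p] repeats the period often enough for its suffix of length p to be that
   of the left-infinite word. *)
Definition delta3 (p : nat) : B3plus :=
  let w := flatten (nseq p [:: s2; s1; s1; s2]) in pbraid (drop (size w - p) w).

Definition lmul (x : B3plus) (S : seq B3plus) : seq B3plus := [seq x * y | y <- S].

Definition S2 (d : nat) : seq B3plus := [seq sigma1 ^+ k | k <- iota 0 d.+1].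

(* [S3sub d p] is the sequence S_3^{d,p}, meaningful for 1 <= p <= 2d; it is
   empty for the other values of p, which are never used. *)
Fixpoint S3sub (d p : nat) : seq B3plus :=
  if d is d'.+1 then
    if (2 <= p <= 2 * d - 1)%N then
      match (p %% 4)%N with
      | 0 => lmul sigma1
          (S3sub d' (p - 1) ++ lmul (delta3 (p - 1)) (S2 d') ++ S3sub d' p)
      | 1 => lmul (sigma2 * sigma1)
          (S3sub d' (p - 2) ++ lmul (delta3 (p - 2)) (S2 d') ++ S3sub d' (p - 1))
      | 2 => lmul sigma2
          (S3sub d' (p - 1) ++ lmul (delta3 (p - 1)) (S2 d') ++ S3sub d' p)
      | _ => lmul (sigma1 * sigma2)
          (S3sub d' (p - 2) ++ lmul (delta3 (p - 2)) (S2 d') ++ S3sub d' (p - 1))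
      end
    else [::]
  else [::].

Definition S3 (d : nat) : seq B3plus :=
  lmul (delta3 0) (S2 d) ++
  flatten [seq S3sub d p ++ lmul (delta3 p) (S2 d) | p <- iota 1 (2 * d)].

Definition increasing_enumeration (S : seq B3plus) (P : B3plus -> Prop) : Prop :=
  [/\ uniq S,
      (forall x, x \in S <-> P x) &
      (forall i j, (i < j < size S)%N -> Bp_lt (nth 1 S i) (nth 1 S j))].

(* Main.v *)
Require Import Defs.
From mathcomp Require Import all_boot.
From mathcomp.classical Require Import boolp.
From mathcomp Require Import ssralg ssrnum ssrint zify.

(** Write x << y when x^-1 y has an expression with sigma_2 but no sigma_2^-1.
This relation implies x < y, is transitive and invariant under left translation,
and does not change when x or y is multiplied on the right by a power of sigma_1.
Up to such a power delta_{2m} is Delta^m and delta_{2m+1} is Delta^m sigma_2, and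
Delta exchanges the generators; by induction on d this puts S_3^{d,p} strictly
between delta_{p-1} and delta_p for <<, so S_3^d is increasing. It is thus
repetition-free, because < is irreflexive: in the action of B_3 on the universal
cover of the punctured plane (lifting SL_2(Z)), sigma_1 fixes the point (1, 0)
and a word that is positive in sigma_2 moves it to a strictly lower level.

All entries of S_3^d divide Delta^d, and they exhaust Div(Delta^d) by counting.
Every positive braid has a normal form Delta^k w with w free of factors Delta; its
length, k plus the number of maximal alternating pieces of w, does not decrease
under right multiplication, so it is at most d on Div(Delta^d). Exactly
2^(d+3) - 3d - 7 normal forms have length at most d, and this is also the number
of entries of S_3^d. *)

Set Implicit Arguments.
Unset Strict Implicit.
Unset Printing Implicit Defensive.

Local Open Scope group_scope.

(** * Powers of Delta and the braids delta_p *)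

Lemma ord2E (i : 'I_2) : i = if i == s2 then s2 else s1.
Proof. by case: i => [[|[|m]] lti] //; apply: val_inj. Qed.

Lemma pbraid_ind (P : B3plus -> Prop) :
  P 1 -> (forall x, P x -> P (sigma1 * x)) -> (forall x, P x -> P (sigma2 * x)) ->
  forall x, P x.
Proof.
move=> P1 Ps1 Ps2 x; rewrite -(word_ofK x) -/(pbraid _).
elim: (word_of x) => [|i u IHu]; first exact: P1.
rewrite -cat1s pbraidM.
by rewrite (ord2E i); case: (i == s2); [exact: Ps2 | exact: Ps1].
Qed.

Definition sg (b : bool) : B3plus := if b then sigma2 else sigma1.

Lemma braid_rel12 : sigma1 * sigma2 * sigma1 = sigma2 * sigma1 * sigma2.
Proof.
have E : pbraid [:: s1; s2; s1] = pbraid [:: s2; s1; s2].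
  exact/class_ofP/(congr_rel BraidRel).
by move: E; rewrite !(pbraidM [:: _] (_ :: _)) !mulgA.
Qed.

Lemma Delta3_sg b : Delta3 = sg b * sg (~~ b) * sg b.
Proof. by case: b; rewrite /Delta3 // braid_rel12. Qed.

Lemma sg_Delta3 b : sg b * Delta3 = Delta3 * sg (~~ b).
Proof. by rewrite {1}(Delta3_sg (~~ b)) (Delta3_sg b) negbK !mulgA. Qed.

Lemma sg_Delta3X b m : sg b * Delta3 ^+ m = Delta3 ^+ m * sg (b (+) odd m).
Proof.
elim: m b => [|m IHm] b; first by rewrite addbF mulg1 mul1g.
by rewrite expgS mulgA sg_Delta3 -mulgA IHm mulgA addNb -addbN.
Qed.

Lemma Delta3X_quasicentral m x : exists y, x * Delta3 ^+ m = Delta3 ^+ m * y.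
Proof.
elim/pbraid_ind: x => [|x [y Exy]|x [y Exy]].
- by exists 1; rewrite mul1g mulg1.
- exists (sg (odd m) * y).
  by rewrite -mulgA Exy (mulgA sigma1) (sg_Delta3X false) -mulgA.
- exists (sg (~~ odd m) * y).
  by rewrite -mulgA Exy (mulgA sigma2) (sg_Delta3X true) -mulgA.
Qed.

Lemma Div_mulr x y z : Div z (x * y) -> Div z x.
Proof. by move=> [t ->]; exists (y * t); rewrite mulgA. Qed.

(** Moving Delta^n leftwards across the cofactor u of x turns x u Delta^n into x Delta^n u' = x y t
    u'. *)
Lemma Div_DeltaX_mul m n x y : Div (Delta3 ^+ m) x -> Div (Delta3 ^+ n) y ->
  Div (Delta3 ^+ (m + n)) (x * y).
Proof.
move=> [u xu] [t yt]; have [u' uu'] := Delta3X_quasicentral n u.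
exists (t * u'); rewrite expgnDr xu -mulgA uu' [in LHS]yt.
by rewrite !mulgA.
Qed.

Lemma Div_Delta_sg b : Div Delta3 (sg b).
Proof. by exists (sg (~~ b) * sg b); rewrite (Delta3_sg b) mulgA. Qed.

Lemma Div_Delta_sg2 b : Div Delta3 (sg b * sg (~~ b)).
Proof. by exists (sg b); rewrite (Delta3_sg b). Qed.

Lemma Div_DeltaX_s1 n : Div (Delta3 ^+ n) (sigma1 ^+ n).
Proof.
elim: n => [|n IHn]; first by exists 1; rewrite !mulg1.
by rewrite (expgS sigma1) -add1n; apply: Div_DeltaX_mul IHn; exact: (Div_Delta_sg false).
Qed.

Lemma Div_DeltaX n : Div (Delta3 ^+ n) (Delta3 ^+ n).
Proof. by exists 1; rewrite mulg1. Qed.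

Lemma delta3_add4 p : delta3 p.+4 =
  delta3 p * (sigma2 * sigma1 * sigma1 * sigma2).
Proof.
have -> : sigma2 * sigma1 * sigma1 * sigma2 = pbraid [:: s2; s1; s1; s2].
  by rewrite !(pbraidM [:: _] (_ :: _)) !mulgA.
rewrite /delta3 -(pbraidM (drop _ _)); congr pbraid.
set W := [:: s2; s1; s1; s2]; set f := fun p => flatten (nseq p W).
have szf q : size (f q) = (4 * q)%N by elim: q => //= q ->; rewrite mulnS.
have fS q : f q.+1 = f q ++ W by elim: q => // q IHq; rewrite [LHS](_ : _ = W ++ f q.+1) // {1}IHq catA.
(* The suffix is cut from p + 4 periods: dropping 3p + 12 letters removes three whole periods, then
   3p letters of the other p + 1. *)
rewrite -/(f p.+4) -/(f p) !szf (_ : f p.+4 = (W ++ W ++ W) ++ f p.+1) //.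
have [-> ->] : (4 * p.+4 - p.+4 = size (W ++ W ++ W) + 3 * p /\ 4 * p - p = 3 * p)%N.
  by rewrite [size _]/=; split; lia.
rewrite addnC -drop_drop drop_size_cat // fS drop_cat szf; case: ltnP => // p3.
by have -> : p = 0%N by lia.
Qed.

(** The period times sigma_1^2 is Delta^2, which is central; hence an induction from m to m + 2. *)
Lemma delta3_half m :
  delta3 m.*2 * sigma1 ^+ m = Delta3 ^+ m /\
  delta3 m.*2.+1 * sigma1 ^+ m = Delta3 ^+ m * sigma2.
Proof.
have E : sigma2 * sigma1 * sigma1 * sigma2 * (sigma1 * sigma1) = Delta3 ^+ 2.
  rewrite expg2 {1}(Delta3_sg true) /Delta3 /= -!mulgA; congr (_ * (_ * _)).
  by rewrite !mulgA -braid_rel12.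
have C : sigma1 * Delta3 ^+ 2 = Delta3 ^+ 2 * sigma1 by rewrite (sg_Delta3X false).
have CX k : sigma1 ^+ k * Delta3 ^+ 2 = Delta3 ^+ 2 * sigma1 ^+ k.
  by apply/esym/commuteX; rewrite /commute C.
have C2 : Delta3 ^+ 2 * sigma2 = sigma2 * Delta3 ^+ 2 by rewrite (sg_Delta3X true).
have step p k : delta3 p.+4 * sigma1 ^+ k.+2 = delta3 p * sigma1 ^+ k * Delta3 ^+ 2.
  by rewrite delta3_add4 -mulgA 2!(expgS sigma1) (mulgA sigma1) (mulgA _ _ (_ ^+ k)) E -CX mulgA.
elim/ltn_ind: m => -[_|[_|m IHm]].
- by rewrite !mulg1 mul1g.
- have [-> ->] : delta3 1.*2 = pbraid [:: s1; s2] /\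
      delta3 1.*2.+1 = pbraid [:: s1; s1; s2] by [].
  rewrite !expg1 !(pbraidM [:: _] (_ :: _)) -/sigma1 -/sigma2.
  by split=> //; rewrite -(sg_Delta3 false) /Delta3 !mulgA.
have [IH1 IH2] := IHm m (leqnSn _).
rewrite !doubleS !step IH1 IH2; split; first by rewrite -expgnDr addn2.
by rewrite -(mulgA _ sigma2) -C2 (mulgA _ _ sigma2) -expgnDr addn2.
Qed.

(** * Normal forms and the divisors of Delta^d *)

(* The pair (k, w) stands for Delta^k times the word w read backwards, with
   true for sigma_2 and false for sigma_1. *)
Definition nf_step (st : nat * seq bool) (i : 'I_2) : nat * seq bool :=
  let a := i == s2 in
  match st.2 with
  | b :: c :: w =>
      if (b != a) && (c == a) then (st.1.+1, map negb w)
      else (st.1, [:: a, b, c & w])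
  | w => (st.1, a :: w)
  end.

Fixpoint Delta_free (w : seq bool) : bool :=
  if w is a :: w' then
    (if w' is b :: c :: _ then ~~ ((b != a) && (c == a)) else true)
    && Delta_free w'
  else true.

(** For nonempty [w], one plus the number of equal neighbours. In a [Delta_free] word the
    alternating pieces are the Garside factors, of one or two letters. *)
Fixpoint canonical_length (w : seq bool) : nat :=
  if w is a :: w' then
    ((if w' is b :: _ then a == b : nat else 1) + canonical_length w')%N
  else 0.

Lemma Delta_free_negb w : Delta_free (map negb w) = Delta_free w.
Proof.
elim: w => [//|a w IHw]; case: w IHw => [|b [|c w]] //= ->.
by case: a b c => [] [] [].
Qed.

Lemma canonical_length_negb w : canonical_length (map negb w) = canonical_length w.
Proof.
elim: w => [//|a w IHw]; case: w IHw => [|b w] //= ->.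
by case: a b => [] [].
Qed.

Lemma Delta_free_step st i : Delta_free st.2 -> Delta_free (nf_step st i).2.
Proof.
case: st => k [|b [|c w]] //=; rewrite /nf_step /=; case: ifP => [_ |/= ->] //=.
by rewrite Delta_free_negb; case: w => // e w /andP[_ /andP[]].
Qed.

(** Appending Delta conjugates the word: both sides are [(st.1.+1, map negb st.2)], by a check on
    its last few letters. *)
Lemma nf_step_braid st : Delta_free st.2 ->
  foldl nf_step st [:: s1; s2; s1] = foldl nf_step st [:: s2; s1; s2].
Proof.
case: st => k w /=; rewrite /nf_step.
case: w => [|[] [|[] [|[] w]]] //=.
all: by case: w => [|[] w].
Qed.

Lemma Delta_free_foldl u st : Delta_free st.2 -> Delta_free (foldl nf_step st u).2.
Proof. by elim: u st => //= i u IHu st /(Delta_free_step i)/IHu. Qed.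

(** Thus B_3^+ acts on the right on states with a Delta-free word, which makes [nf] independent of
    the chosen representative. *)
Lemma foldl_nf_congr u v : congruence braid_rel u v ->
  forall st, Delta_free st.2 -> foldl nf_step st u = foldl nf_step st v.
Proof.
elim=> {u v} [u v []|//|u v _ IH|u v w _ IH1 _ IH2|u u' v v' _ IH1 _ IH2] st fst.
- exact: nf_step_braid.
- by rewrite IH.
- by rewrite IH1 // IH2.
- by rewrite !foldl_cat IH1 // IH2 // Delta_free_foldl.
Qed.

Definition nf (x : B3plus) : nat * seq bool := foldl nf_step (0, [::]) (word_of x).

Lemma nf_pbraid u : nf (pbraid u) = foldl nf_step (0, [::]) u.
Proof. by apply: foldl_nf_congr; first exact: class_of_word. Qed.

Lemma nfM x y : nf (x * y) = foldl nf_step (nf x) (word_of y).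
Proof. by rewrite -{1}[x]word_ofK -{1}[y]word_ofK -[_ * _]pbraidM nf_pbraid foldl_cat. Qed.

Lemma Delta_free_nf x : Delta_free (nf x).2.
Proof. exact: Delta_free_foldl. Qed.

Definition nf_val (st : nat * seq bool) : B3plus :=
  Delta3 ^+ st.1 * foldr (fun b x => x * sg b) 1 st.2.

Lemma foldr_sg_Delta3 w :
  foldr (fun b x => x * sg b) 1 w * Delta3 =
  Delta3 * foldr (fun b x => x * sg b) 1 (map negb w).
Proof.
elim: w => [|b w IHw] /=; first by rewrite mulg1 mul1g.
by rewrite -mulgA sg_Delta3 mulgA IHw -mulgA.
Qed.

Lemma nf_val_step st i : nf_val (nf_step st i) = nf_val st * pbraid [:: i].
Proof.
have -> : pbraid [:: i] = sg (i == s2) by rewrite {1}(ord2E i); case: (i == s2).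
case: st => k w; rewrite /nf_val /nf_step; move: (i == s2) => a.
case: w => [|b [|c w]] //=; first by rewrite mulg1 mul1g.
  by rewrite !mulgA.
(* The two last letters and the new one spell Delta; carrying it to the front exchanges the
   generators in [w]. *)
case: ifP => [/andP[ba /eqP ->]|_] /=; last by rewrite !mulgA.
have -> : b = ~~ a by case: (b) (a) ba => [] [].
by rewrite expgSr -mulgA -foldr_sg_Delta3 (Delta3_sg a) !mulgA.
Qed.

Lemma nfK : cancel nf nf_val.
Proof.
move=> x; rewrite /nf -[RHS](word_ofK x) -/(pbraid _).
elim/last_ind: (word_of x) => [|u i IHu]; first exact: mulg1.
by rewrite -cats1 foldl_cat pbraidM -IHu -nf_val_step.
Qed.

(** * Monotonicity of the length and the count of short normal forms *)

Definition nf_length st := (st.1 + canonical_length st.2)%N.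

(** When a Delta is split off, the two letters removed account for at most one alternating piece,
    and the exponent of Delta makes up for it. *)
Lemma nf_length_step st i : Delta_free st.2 -> (nf_length st <= nf_length (nf_step st i))%N.
Proof.
case: st => k w; rewrite /nf_length /nf_step; move: (i == s2) => a.
case: w => [|b [|c w]] /=; [lia | lia |].
case: ifP => [/andP[ba /eqP ->]|_] /=; last lia.
rewrite canonical_length_negb.
by case: a b ba => [] [] //= _; case: w => [|[] w] /=; lia.
Qed.

Lemma Div_nf_length d x : Div (Delta3 ^+ d) x -> (nf_length (nf x) <= d)%N.
Proof.
have mono u st : Delta_free st.2 -> (nf_length st <= nf_length (foldl nf_step st u))%N.
  elim: u st => //= i u IHu st fst.
  by apply: leq_trans (nf_length_step i fst) (IHu _ _); exact: Delta_free_step.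
have Ed : nf_length (nf (Delta3 ^+ d)) = d.
  suff -> : nf (Delta3 ^+ d) = (d, [::]) by rewrite /nf_length addn0.
  elim: d => [|d IHd]; first exact: (nf_pbraid [::]).
  rewrite expgSr nfM IHd.
  have -> : Delta3 = pbraid [:: s1; s2; s1].
    by rewrite !(pbraidM [:: _] (_ :: _)) mulgA.
  by apply: (etrans (foldl_nf_congr (class_of_word _ _) _)).
by case=> t E; rewrite -{}Ed E nfM; apply: mono; exact: Delta_free_nf.
Qed.

(** A further piece starts by repeating the last letter and may then alternate once. There [w] is
    nonempty, so the default of [head] is never reached. *)
Fixpoint Delta_free_words (m : nat) : seq (seq bool) :=
  match m with
  | 0 => [:: [::]]
  | 1 => [:: [:: true]; [:: false]; [:: true; false]; [:: false; true]]
  | m.+1 => flatten [seq [:: head true w :: w; [:: ~~ head true w, head true w & w]]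
                    | w <- Delta_free_words m]
  end.

Fixpoint nf_list (d : nat) : seq (nat * seq bool) :=
  [seq (0, w) | w <- flatten [seq Delta_free_words m | m <- iota 0 d.+1]] ++
  (if d is d'.+1 then [seq (st.1.+1, st.2) | st <- nf_list d'] else [::]).

Lemma canonical_length_gt0 a w : (0 < canonical_length (a :: w))%N.
Proof. by elim: w a => //= b w IHw a; have := IHw b; lia. Qed.

Lemma mem_Delta_free_words w :
  Delta_free w -> w \in Delta_free_words (canonical_length w).
Proof.
move: {2}(size w) (leqnn (size w)) => n; elim: n w => [|n IHn] [|a [|b w]] //=; first by case: a.
rewrite ltnS => szw.
have [<-|ab] := eqVneq a b => /andP[].
  move=> _ fw; have := IHn (a :: w) szw fw.
  rewrite -/(canonical_length (a :: w)) add1n.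
  case: (canonical_length (a :: w)) (canonical_length_gt0 a w) => // m _ aw.
  apply/flattenP; exists [:: a :: a :: w; [:: ~~ a, a, a & w]]; last by rewrite inE eqxx.
  by apply/mapP; exists (a :: w).
have -> : a = ~~ b by case: (a) (b) ab => [] [].
case: w szw => [|c w szw]; first by case: (b).
(* Otherwise the first three letters would spell Delta. So two letters are peeled off as one
   piece. *)
have [-> _|bc] := eqVneq b c; last by case: (b) (c) bc => [] [].
move=> /andP[_ fw]; have := IHn (c :: w) (ltnW szw) fw.
rewrite -/(canonical_length (c :: w)) add0n add1n.
case: (canonical_length (c :: w)) (canonical_length_gt0 c w) => // m _ aw.
apply/flattenP; exists [:: c :: c :: w; [:: ~~ c, c, c & w]]; last by rewrite !inE eqxx orbT.
by apply/mapP; exists (c :: w).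
Qed.

Lemma mem_nf_list d st : Delta_free st.2 -> (nf_length st <= d)%N -> st \in nf_list d.
Proof.
have mem0 e w : Delta_free w -> (canonical_length w <= e)%N -> (0%N, w) \in nf_list e.
  move=> fw le; have : w \in flatten [seq Delta_free_words m | m <- iota 0 e.+1].
    apply/flattenP; exists (Delta_free_words (canonical_length w)).
      by apply: map_f; rewrite mem_iota.
    exact: mem_Delta_free_words.
  by case: e {le} => [|e] we; rewrite mem_cat map_f.
elim: d st => [|d IHd] [[|k] w] fw le; try exact: mem0.
  by move: le; rewrite /nf_length.
rewrite mem_cat; apply/orP; right; apply/mapP; exists (k, w) => //.
by apply: IHd.
Qed.

(** [Delta_free_words m] has 2^(m+1) entries for m > 0, which gives 2^(n+2) - 3 words of length at
    most n; then sum over the exponent of Delta. *)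
Lemma size_nf_list d : (size (nf_list d) + 3 * d + 7 = 2 ^ d.+3)%N.
Proof.
have szw m : size (Delta_free_words m.+1) = (2 ^ m.+2)%N.
  elim: m => // m IHm; rewrite [Delta_free_words _](_ : _ = flatten (map
    (fun w => [:: head true w :: w; [:: ~~ head true w, head true w & w]])
    (Delta_free_words m.+1))) //.
  rewrite size_flatten /shape -map_comp expnS -IHm.
  by elim: (Delta_free_words _) => //= w ws ->; rewrite mulnS.
have szf n : (size (flatten [seq Delta_free_words m | m <- iota 0 n.+1]) + 3 = 2 ^ n.+2)%N.
  elim: n => // n IHn.
  have -> : iota 0 n.+2 = rcons (iota 0 n.+1) n.+1 by rewrite -cats1 -[n.+2]addn1 iotaD.
  by move: IHn; rewrite map_rcons flatten_rcons size_cat szw !expnS; lia.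
elim: d => // d IHd.
rewrite [nf_list _](_ : _ =
  [seq (0%N, w) | w <- flatten [seq Delta_free_words m | m <- iota 0 d.+2]] ++
  [seq (st.1.+1, st.2) | st <- nf_list d]) // size_cat !size_map.
by have := szf d.+1; move: IHd; rewrite !expnS; lia.
Qed.

(** * The braid order *)

Definition upper (x y : int) : bool := ((0 < y) || (y == 0) && (0 < x))%R.

(* The vector (-1)^n (x, y), with (x, y) in the half-open upper half-plane, at the
   level n of the universal cover of the punctured plane. *)
Definition cover_point : Type := (int * int * int)%type.

Definition on_cover (s : cover_point) : bool := upper s.1.2 s.2.

(* sigma_1 and sigma_2 act by lifts of the transvections (x, y) -> (x + y, y) and
   (x, y) -> (x, y - x); the second one may cross the half-line where n drops. *)
Definition cover_act (s : cover_point) (a : signed_letter) : cover_point :=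
  let: (n, x, y) := s in
  (match a.1 == s2, a.2 with
  | false, true => (n, x + y, y)
  | false, false => (n, x - y, y)
  | true, true => if upper x (y - x) then (n, x, y - x) else (n - 1, - x, x - y)
  | true, false => if upper x (y + x) then (n, x, y + x) else (n + 1, - x, - x - y)
  end)%R.

Lemma on_cover_act s a : on_cover s -> on_cover (cover_act s a).
Proof.
case: s a => [[n x] y] [i b]; rewrite /on_cover /cover_act /=.
by case: (i == s2); case: b => /=; do ?[case: ifP]; rewrite /upper /=; lia.
Qed.

Lemma cover_act_rel u v s : signed_rel u v -> on_cover s ->
  foldl cover_act s u = foldl cover_act s v.
Proof.
case: s => [[n x] y]; rewrite /on_cover /=; case=> {u v} [u v []|i b] /=.
  rewrite /cover_act /= /upper.
  by do ![case: ifP]; move=> *; congr (_, _, _); lia.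
rewrite /cover_act /=; case: (i == s2); case: b => /=; rewrite /upper.
all: do ?[case: ifP]; move=> *; congr (_, _, _); lia.
Qed.

Lemma on_cover_foldl u s : on_cover s -> on_cover (foldl cover_act s u).
Proof. by elim: u s => //= a u IHu s /(on_cover_act a)/IHu. Qed.

Lemma cover_act_congr u v : congruence signed_rel u v ->
  forall s, on_cover s -> foldl cover_act s u = foldl cover_act s v.
Proof.
elim=> {u v} [u v uv|//|u v _ IH|u v w _ IH1 _ IH2|u u' v v' _ IH1 _ IH2] s cs.
- exact: cover_act_rel.
- by rewrite IH.
- by rewrite IH1 // IH2.
- by rewrite !foldl_cat IH1 // IH2 // on_cover_foldl.
Qed.

Definition s2_positive (w : seq signed_letter) : bool :=
  ((s2, true) \in w) && ((s2, false) \notin w).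

Lemma sigma_positiveE w : sigma_positive w ->
  s2_positive w \/ exists n, w = nseq n.+1 (s1, true).
Proof.
case=> m [[_ wm] mw m'w].
move: mw m'w; rewrite (ord2E m); case: ifPn => [/eqP Em|m2] mw m'w; [left | right].
  by rewrite /s2_positive mw.
have m1 : m = s1 by rewrite (ord2E m) (negbTE m2).
have E : w = nseq (size w) (s1, true).
  apply/all_pred1P/allP => -[i b] ibw.
  have i1 : i = s1 by apply: val_inj; have := wm _ ibw; rewrite m1 leqn0 => /eqP.
  by rewrite i1 in ibw *; case: b ibw => // ibw; rewrite ibw in m'w.
by case: w E mw {wm m'w} => //= a w -> _; exists (size w).
Qed.

(** Starting from (1, 0) at level 0, letters sigma_1^{+-1} fix the point, the first sigma_2 sends it
    to level -1, and only sigma_2^-1 could raise the level again. *)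
Lemma s2_positive_neq1 w : s2_positive w -> braid w <> 1.
Proof.
case/andP=> w2 w2' /class_ofP/cover_act_congr/(_ (0, 1, 0)%R isT) /=.
set p : cover_point := (0, 1, 0)%R => E.
have neg u s : (s2, false) \notin u -> on_cover s -> (s.1.1 < 0)%R ->
    ((foldl cover_act s u).1.1 < 0)%R.
  elim: u s => //= -[i b] u IHu s; rewrite inE negb_or => /andP[ib u2] cs s0.
  apply: IHu u2 (on_cover_act _ cs) _.
  move: s0 ib; rewrite {1}(ord2E i); case: s cs => [[n x] y] _ /= n0.
  by case: (i == s2); case: b => //= _; case: ifP => /= _; lia.
suff : ((foldl cover_act p w).1.1 < 0)%R by rewrite E.
elim: w w2 w2' {E} => // -[i b] w IHw; rewrite !inE negb_or.
rewrite (_ : foldl _ _ _ = foldl cover_act (cover_act p (i, b)) w) //.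
have [->|i1] := eqVneq i s2.
  by case: b => _ /andP[w21 w2] //; exact: neg.
have -> : i = s1 by rewrite (ord2E i) (negbTE i1).
have -> : cover_act p (s1, b) = p by case: b.
exact: IHw.
Qed.

Lemma B3_lt_irr x : ~ B3_lt x x.
Proof.
case=> w; rewrite mulVg => /sigma_positiveE[/s2_positive_neq1 wn1 /esym //|[n ->]].
(* Positive powers of sigma_1 are detected by another point, (0, 1), which they shear. *)
move=> /esym/class_ofP/cover_act_congr/(_ (0, 0, 1)%R isT) /=.
suff -> x0 m : foldl cover_act (0, x0, 1)%R (nseq m (s1, true)) = (0, x0 + m%:Z, 1)%R.
  by case; lia.
elim: m x0 => [|m IHm] x0 /=; first by rewrite GRing.addr0.
by rewrite IHm; congr (_, _, _); lia.
Qed.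

(** * The relation << and right multiplication by powers of sigma_1 *)

Definition Bp_ll (x y : B3plus) : Prop :=
  exists2 w, s2_positive w & (to_B3 x)^-1 * to_B3 y = braid w.

Lemma s2_positive_cat u v : s2_positive u -> s2_positive v -> s2_positive (u ++ v).
Proof.
by rewrite /s2_positive !mem_cat negb_or => /andP[-> ->] /andP[_ ->].
Qed.

Lemma Bp_ll_trans y x z : Bp_ll x y -> Bp_ll y z -> Bp_ll x z.
Proof.
move=> [u u2 Eu] [v v2 Ev]; exists (u ++ v); first exact: s2_positive_cat.
by rewrite braidM -Eu -Ev !mulgA mulgK.
Qed.

Lemma Bp_lt_ll x y : Bp_ll x y -> Bp_lt x y.
Proof.
move=> [w /andP[w2 w2'] E]; exists w => //; exists s2; split=> //.
split; first by exists true.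
by move=> [i b] _; rewrite -ltnS ltn_ord.
Qed.

Lemma to_B3_quot z x y :
  (to_B3 (z * x))^-1 * to_B3 (z * y) = (to_B3 x)^-1 * to_B3 y.
Proof. by rewrite !to_B3M invgM -mulgA mulKg. Qed.

Lemma Bp_ll_mull z x y : Bp_ll (z * x) (z * y) <-> Bp_ll x y.
Proof. by rewrite /Bp_ll to_B3_quot. Qed.

Lemma Bp_lt_mull z x y : Bp_lt (z * x) (z * y) <-> Bp_lt x y.
Proof. by rewrite /Bp_lt /B3_lt to_B3_quot. Qed.

Lemma to_B3_s1X k : to_B3 (sigma1 ^+ k) = braid (nseq k (s1, true)).
Proof.
have -> : sigma1 ^+ k = pbraid (nseq k s1).
  by elim: k => // k IHk; rewrite expgS IHk -(pbraidM [:: s1]).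
by rewrite to_B3_pbraid /pos_word map_nseq.
Qed.

Lemma to_B3_s1XV k : (to_B3 (sigma1 ^+ k))^-1 = braid (nseq k (s1, false)).
Proof.
apply: mulg1_eq; rewrite to_B3_s1X -braidM.
apply/class_ofP; have := cat_inv_word (nseq k (s1, true)).
by rewrite /inv_word map_nseq rev_nseq.
Qed.

Lemma s2_positive_pad k l b c w :
  s2_positive w -> s2_positive (nseq k (s1, b) ++ w ++ nseq l (s1, c)).
Proof.
by rewrite /s2_positive !mem_cat !mem_nseq !negb_or => /andP[-> ->]; rewrite !andbF orbT.
Qed.

Lemma Bp_ll_s1r k l x y : Bp_ll (x * sigma1 ^+ k) (y * sigma1 ^+ l) <-> Bp_ll x y.
Proof.
split=> -[w w2 E].
  exists (nseq k (s1, true) ++ w ++ nseq l (s1, false)); first exact: s2_positive_pad.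
  rewrite !braidM -E -to_B3_s1X -to_B3_s1XV !to_B3M invgM -!mulgA.
  by rewrite mulVKg mulgV mulg1.
exists (nseq k (s1, false) ++ w ++ nseq l (s1, true)); first exact: s2_positive_pad.
by rewrite !braidM -E -to_B3_s1X -to_B3_s1XV !to_B3M invgM -!mulgA.
Qed.

Lemma Bp_ll_mulr x u : s2 \in u -> Bp_ll x (x * pbraid u).
Proof.
move=> u2; exists (pos_word u); last by rewrite to_B3M mulKg to_B3_pbraid.
apply/andP; split; first by apply/mapP; exists s2.
by apply/mapP => -[].
Qed.

Lemma Bp_lt_s1X k l : (k < l)%N -> Bp_lt (sigma1 ^+ k) (sigma1 ^+ l).
Proof.
move=> kl; exists (nseq (l - k) (s1, true)).
  exists s1; rewrite !mem_nseq subn_gt0 kl; split=> //.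
  split; first by exists true; rewrite mem_nseq subn_gt0 kl eqxx.
  by move=> a; rewrite mem_nseq => /andP[_ /eqP->].
by rewrite -to_B3_s1X -(subnKC (ltnW kl)) expgnDr to_B3M mulKg addKn.
Qed.

(** Expresses equality of cosets modulo powers of sigma_1; two nonnegative exponents keep it inside
    the monoid. *)
Definition eqs1 (x y : B3plus) : Prop :=
  exists k l, x * sigma1 ^+ k = y * sigma1 ^+ l.

Lemma eqs1_refl x : eqs1 x x. Proof. by exists 0, 0. Qed.

Lemma eqs1_sym x y : eqs1 x y -> eqs1 y x.
Proof. by move=> [k [l E]]; exists l, k. Qed.

Lemma eqs1_trans y x z : eqs1 x y -> eqs1 y z -> eqs1 x z.
Proof.
move=> [k [l E]] [m [n F]]; exists (k + m)%N, (n + l)%N.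
by rewrite !expgnDr !mulgA E -F -!mulgA -!expgnDr addnC.
Qed.

Lemma eqs1_mull z x y : eqs1 x y -> eqs1 (z * x) (z * y).
Proof. by move=> [k [l E]]; exists k, l; rewrite -!mulgA E. Qed.

Lemma eqs1_s1r x k : eqs1 (x * sigma1 ^+ k) x.
Proof. by exists 0, k; rewrite mulg1. Qed.

Lemma Bp_ll_eqs1 x y x' y' : eqs1 x x' -> eqs1 y y' -> Bp_ll x y -> Bp_ll x' y'.
Proof.
move=> [k [l E]] [m [n F]] xy; apply/(Bp_ll_s1r l n).
by rewrite -E -F; apply/Bp_ll_s1r.
Qed.

(** * The sequences S_3^{d,p} *)

Lemma delta3_even_eqs1 m : eqs1 (delta3 m.*2) (Delta3 ^+ m).
Proof. by have [<- _] := delta3_half m; apply/eqs1_sym/eqs1_s1r. Qed.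

Lemma delta3_odd_eqs1 m : eqs1 (delta3 m.*2.+1) (Delta3 ^+ m * sigma2).
Proof. by have [_ <-] := delta3_half m; apply/eqs1_sym/eqs1_s1r. Qed.

(** Modulo powers of sigma_1 the steps are Delta^m, Delta^m sigma_2, Delta^m sigma_2 sigma_1 sigma_2
    = Delta^(m+1), and each inserts a sigma_2. *)
Lemma delta3_ll p : Bp_ll (delta3 p) (delta3 p.+1).
Proof.
rewrite -(odd_double_half p); move: p./2 => m; case: (odd p).
  rewrite add1n -doubleS.
  apply: Bp_ll_eqs1 (eqs1_sym (delta3_odd_eqs1 m)) (eqs1_sym (delta3_even_eqs1 m.+1)) _.
  have -> : Delta3 ^+ m.+1 = Delta3 ^+ m * sigma2 * pbraid [:: s1; s2].
    by rewrite expgSr {2}(Delta3_sg true) (pbraidM [:: _] [:: _]) !mulgA.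
  exact: Bp_ll_mulr.
apply: Bp_ll_eqs1 (eqs1_sym (delta3_even_eqs1 m)) (eqs1_sym (delta3_odd_eqs1 m)) _.
exact: Bp_ll_mulr.
Qed.

Lemma Div_delta3 d q k : (q <= d.*2)%N -> (k <= d)%N ->
  Div (Delta3 ^+ d) (delta3 q * sigma1 ^+ k).
Proof.
move=> qd kd; apply: (@Div_mulr _ (sigma1 ^+ (d - k))).
rewrite -mulgA -expgnDr subnKC //.
move: qd; rewrite -(odd_double_half q); move: q./2 => m; case: (odd q) => /= md.
  (* With k raised to d, the odd case is Delta^m (sigma_2 sigma_1) sigma_1^(d-m-1), a product of
     divisors of Delta^m, Delta and Delta^(d-m-1). *)
  have -> : d = (m + (1 + (d - m.+1)))%N by lia.
  rewrite (expgnDr sigma1) add1n mulgA (proj2 (delta3_half m)) (expgS sigma1) mulgA -(mulgA _ sigma2).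
  rewrite -mulgA; apply/Div_DeltaX_mul; first exact: Div_DeltaX.
  rewrite -add1n; apply/Div_DeltaX_mul; last exact: Div_DeltaX_s1.
  by rewrite expg1; exact: (Div_Delta_sg2 true).
rewrite -(@subnKC m d); last by lia.
rewrite (expgnDr sigma1) mulgA (proj1 (delta3_half m)).
by apply/Div_DeltaX_mul; [exact: Div_DeltaX | exact: Div_DeltaX_s1].
Qed.

Lemma S3sub_nil d p : (p <= 1)%N || (d.*2 <= p)%N -> S3sub d p = [::].
Proof.
case: d => // d pd; rewrite /S3sub -/S3sub.
by case: ifP => // /andP[p2 pd']; lia.
Qed.

(** The bracket shared by the recursions for S_3^{d+1,2m+2} and S_3^{d+1,2m+3}. *)
Definition S3sub_mid d m : seq B3plus :=
  S3sub d m.*2.+1 ++ lmul (delta3 m.*2.+1) (S2 d) ++ S3sub d m.+1.*2.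

(* The left factor in the definition of S_3^{d,p} for p = b + 2 (m + 1). *)
Definition S3sub_mul (b : bool) m : B3plus :=
  if b then sg (odd m) * sg (~~ odd m) else sg (~~ odd m).

Lemma S3subS d m (b : bool) : (m < d)%N ->
  S3sub d.+1 (b + m.+1.*2) = lmul (S3sub_mul b m) (S3sub_mid d m).
Proof.
move=> md; rewrite /S3sub -/S3sub.
rewrite ifT; last by case: b; lia.
have -> : ((b + m.+1.*2) %% 4 = b + (~~ odd m).*2)%N by lia.
rewrite /S3sub_mul /S3sub_mid; case: b => /=.
  have -> : (true + m.+1.*2 - 2 = m.*2.+1)%N by lia.
  have -> : (true + m.+1.*2 - 1 = m.+1.*2)%N by lia.
  by case: (odd m).
have -> : (false + m.+1.*2 - 1 = m.*2.+1)%N by lia.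
by case: (odd m).
Qed.

Lemma S3sub_mul_Div b m : Div Delta3 (S3sub_mul b m).
Proof.
case: b; last exact: Div_Delta_sg.
exact: Div_Delta_sg2.
Qed.

(** Carried past Delta^m, the multiplier becomes sigma_2 or sigma_1 sigma_2, whatever the parity of
    m. *)
Lemma S3sub_mul_low b m : eqs1 (S3sub_mul b m * delta3 m.*2) (delta3 (b + m.+1.*2).-1).
Proof.
apply: (eqs1_trans (eqs1_mull _ (delta3_even_eqs1 m))).
case: b; rewrite /S3sub_mul.
  apply: eqs1_trans (eqs1_sym (delta3_even_eqs1 m.+1)).
  rewrite -mulgA !sg_Delta3X mulgA !sg_Delta3X addNb addbb.
  (* One more sigma_1 completes Delta^m sigma_1 sigma_2 to Delta^(m+1). *)
  exists 1%N, 0%N; rewrite mulg1 expg1 expgSr (Delta3_sg false) !mulgA.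
  by rewrite /=.
rewrite sg_Delta3X addNb addbb; exact/eqs1_sym/delta3_odd_eqs1.
Qed.

(** Carried past Delta^(m+1), the multiplier becomes sigma_1 or sigma_2 sigma_1, whose final sigma_1
    is discarded. *)
Lemma S3sub_mul_high b m : eqs1 (S3sub_mul b m * delta3 m.+1.*2) (delta3 (b + m.+1.*2)).
Proof.
apply: (eqs1_trans (eqs1_mull _ (delta3_even_eqs1 m.+1))).
case: b; rewrite /S3sub_mul.
  apply: eqs1_trans (eqs1_sym (delta3_odd_eqs1 m.+1)).
  rewrite -mulgA !sg_Delta3X mulgA !sg_Delta3X /= addNb addbN addbb.
  exact: (eqs1_s1r _ 1%N).
apply: eqs1_trans (eqs1_sym (delta3_even_eqs1 m.+1)).
rewrite sg_Delta3X /= addNb addbN addbb; exact: (eqs1_s1r _ 1%N).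
Qed.

Lemma S3sub_cases d p : S3sub d p = [::] \/
  exists d' m (b : bool), [/\ d = d'.+1, p = (b + m.+1.*2)%N & (m < d')%N].
Proof.
have [?|] := boolP ((p <= 1)%N || (d.*2 <= p)%N); first by left; exact: S3sub_nil.
case: d => [|d]; first by lia.
move=> pd; right; exists d, p./2.-1, (odd p); split=> //.
  by rewrite -[LHS]odd_double_half; lia.
lia.
Qed.

Lemma mem_delta3_S2 x q d : x \in lmul (delta3 q) (S2 d) ->
  exists2 k, (k <= d)%N & x = delta3 q * sigma1 ^+ k.
Proof.
by move=> /mapP[_ /mapP[k kd ->] ->]; exists k => //; move: kd; rewrite mem_iota.
Qed.

Lemma S3sub_Div d p x : x \in S3sub d p -> Div (Delta3 ^+ d) x.
Proof.
elim: d p x => // d IHd p x.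
have [->//|[_ [m [b [[<-] -> md]]]]] := S3sub_cases d.+1 p.
rewrite S3subS // => /mapP[y ymid ->]; rewrite -add1n.
apply: Div_DeltaX_mul; first by rewrite expg1; exact: S3sub_mul_Div.
move: ymid; rewrite !mem_cat => /or3P[/IHd|/mem_delta3_S2[k kd ->]|/IHd] //.
by apply: Div_delta3; lia.
Qed.

Definition Bp_ltb x y := `[< Bp_lt x y >].

Lemma pairwise_lmul c S : pairwise Bp_ltb (lmul c S) = pairwise Bp_ltb S.
Proof.
rewrite pairwise_map; apply: eq_pairwise => x y /=.
by apply/asboolP/asboolP => /Bp_lt_mull.
Qed.

Lemma pairwise_S2 d : pairwise Bp_ltb (S2 d).
Proof.
rewrite pairwise_map; apply: (@sub_pairwise _ ltn).
  by move=> k l kl; apply/asboolP/Bp_lt_s1X.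
by rewrite -sorted_pairwise ?iota_ltn_sorted //; exact: ltn_trans.
Qed.

Lemma S3sub_between d p x :
  x \in S3sub d p -> Bp_ll (delta3 p.-1) x /\ Bp_ll x (delta3 p).
Proof.
elim: d p x => // d IHd p x.
have [->//|[_ [m [b [[<-] -> md]]]]] := S3sub_cases d.+1 p.
rewrite S3subS // => /mapP[y ymid ->].
(* The multiplier takes these bounds to delta_{p-1} and delta_p. Inside the bracket, the middle part
   is delta_{2m+1} up to powers of sigma_1 and separates the two others. *)
suff [lo hi] : Bp_ll (delta3 m.*2) y /\ Bp_ll y (delta3 m.+1.*2).
  split.
    by apply: Bp_ll_eqs1 (S3sub_mul_low b m) (eqs1_refl _) _; apply/Bp_ll_mull.
  by apply: Bp_ll_eqs1 (eqs1_refl _) (S3sub_mul_high b m) _; apply/Bp_ll_mull.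
move: ymid; rewrite !mem_cat => /or3P[/IHd[lo hi]|/mem_delta3_S2[k kd ->]|/IHd[lo hi]].
- by split=> //; apply: Bp_ll_trans hi (delta3_ll _).
- split; first exact: Bp_ll_eqs1 (eqs1_refl _) (eqs1_sym (eqs1_s1r _ k)) (delta3_ll _).
  exact: Bp_ll_eqs1 (eqs1_sym (eqs1_s1r _ k)) (eqs1_refl _) (delta3_ll _).
- by split=> //; apply: Bp_ll_trans (delta3_ll _) lo.
Qed.

Lemma pairwise_S3sub d p : pairwise Bp_ltb (S3sub d p).
Proof.
elim: d p => // d IHd p.
have [->//|[_ [m [b [[<-] -> md]]]]] := S3sub_cases d.+1 p.
rewrite S3subS // pairwise_lmul !pairwise_cat !IHd pairwise_lmul pairwise_S2 !andbT.
apply/andP; split; apply/allrelP => x y.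
  move=> /S3sub_between[_ hi]; rewrite mem_cat => /orP[/mem_delta3_S2[k _ ->]|/S3sub_between[lo _]].
    apply/asboolP/Bp_lt_ll.
    exact: Bp_ll_eqs1 (eqs1_refl _) (eqs1_sym (eqs1_s1r _ k)) hi.
  exact/asboolP/Bp_lt_ll/(Bp_ll_trans hi).
move=> /mem_delta3_S2[k _ ->] /S3sub_between[lo _]; apply/asboolP/Bp_lt_ll.
exact: Bp_ll_eqs1 (eqs1_sym (eqs1_s1r _ k)) (eqs1_refl _) lo.
Qed.

(** * The whole sequence S_3^d, built up by truncation after delta_n S_2^d *)

Definition S3upto d n : seq B3plus :=
  lmul (delta3 0) (S2 d) ++
  flatten [seq S3sub d p ++ lmul (delta3 p) (S2 d) | p <- iota 1 n].

Lemma S3uptoS d n :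
  S3upto d n.+1 = S3upto d n ++ S3sub d n.+1 ++ lmul (delta3 n.+1) (S2 d).
Proof.
have E : iota 1 n.+1 = rcons (iota 1 n) n.+1 by rewrite -cats1 -[n.+1]addn1 iotaD addn1.
by rewrite /S3upto E map_rcons flatten_rcons catA.
Qed.

Lemma S3upto_ll d n x z : x \in S3upto d n -> Bp_ll (delta3 n) z -> Bp_ll x z.
Proof.
have S2_ll q y : y \in lmul (delta3 q) (S2 d) -> Bp_ll (delta3 q) z -> Bp_ll y z.
  move=> /mem_delta3_S2[k _ ->].
  exact: Bp_ll_eqs1 (eqs1_sym (eqs1_s1r _ k)) (eqs1_refl _).
elim: n => [|n IHn]; first by rewrite mem_cat orbF; exact: S2_ll.
rewrite S3uptoS mem_cat => /orP[xn nz|]; last rewrite mem_cat => /orP[/S3sub_between[_ hi]|].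
- by apply: IHn xn _; exact: Bp_ll_trans (delta3_ll n) nz.
- exact: Bp_ll_trans.
- exact: S2_ll.
Qed.

Lemma pairwise_S3upto d n : pairwise Bp_ltb (S3upto d n).
Proof.
elim: n => [|n IHn]; first by rewrite /S3upto cats0 pairwise_lmul pairwise_S2.
rewrite S3uptoS pairwise_cat IHn pairwise_cat pairwise_S3sub pairwise_lmul pairwise_S2 !andbT /=.
apply/andP; split; apply/allrelP => x y.
  move=> /S3upto_ll xz; rewrite mem_cat => /orP[/S3sub_between[lo _]|/mem_delta3_S2[k _ ->]].
    exact/asboolP/Bp_lt_ll/xz.
  apply/asboolP/Bp_lt_ll/xz.
  exact: Bp_ll_eqs1 (eqs1_refl _) (eqs1_sym (eqs1_s1r _ k)) (delta3_ll n).
move=> /S3sub_between[_ hi] /mem_delta3_S2[k _ ->]; apply/asboolP/Bp_lt_ll.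
exact: Bp_ll_eqs1 (eqs1_refl _) (eqs1_sym (eqs1_s1r _ k)) hi.
Qed.

Lemma uniq_S3 d : uniq (S3 d).
Proof.
apply: (pairwise_uniq _ (pairwise_S3upto d (2 * d))) => x.
by apply/asboolP; exact: B3_lt_irr.
Qed.

Lemma S3_Div d x : x \in S3 d -> Div (Delta3 ^+ d) x.
Proof.
rewrite mem_cat => /orP[/mem_delta3_S2[k kd ->]|]; first exact: Div_delta3.
case/flattenP => s /mapP[p]; rewrite mem_iota => pd ->.
rewrite mem_cat => /orP[/S3sub_Div //|/mem_delta3_S2[k kd ->]].
by apply: Div_delta3; lia.
Qed.

Lemma size_S3 d : (size (S3 d) + 3 * d + 7 = 2 ^ d.+3)%N.
Proof.
set B := fun e => (\sum_(k < e) (size (S3sub e k.*2.+1) + size (S3sub e k.+1.*2)))%N.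
have szS2 q : size (lmul (delta3 q) (S2 d)) = d.+1 by rewrite !size_map size_iota.
have szS n : size (S3upto d n.+1) = (size (S3upto d n) + (size (S3sub d n.+1) + d.+1))%N.
  by rewrite S3uptoS size_cat size_cat szS2.
have szup n : size (S3upto d n.*2) = ((n.*2.+1 * d.+1) +
    \sum_(k < n) (size (S3sub d k.*2.+1) + size (S3sub d k.+1.*2)))%N.
  elim: n => [|n IHn]; first by rewrite /S3upto cats0 szS2 big_ord0; lia.
  by rewrite doubleS !szS IHn big_ord_recr /= doubleS; lia.
(* [B e] counts the entries of all S_3^{e,p}. Level e + 1 uses each of the e brackets of level e
   twice, and each bracket adds e + 1 entries from S_2^e. *)
have BS e : (B e.+1 = 2 * B e + 2 * e * e.+1)%N.
  pose f k := size (S3sub e.+1 k).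
  have f1 : f 1%N = 0%N by rewrite /f S3sub_nil.
  have f2 : f e.+1.*2 = 0%N by rewrite /f S3sub_nil // leqnn orbT.
  have fmid (b : bool) k : (k < e)%N -> f (b + k.+1.*2)%N =
      (size (S3sub e k.*2.+1) + size (S3sub e k.+1.*2) + e.+1)%N.
    by move=> ke; rewrite /f S3subS // size_map !size_cat !size_map size_iota (addnC e.+1) addnA.
  have -> : B e.+1 = (\sum_(k < e.+1) (f k.*2.+1 + f k.+1.*2))%N by [].
  move: (f) f1 f2 fmid => {}f f1 f2 fmid.
  (* The extreme terms p = 1 and p = 2e + 2 vanish, so the sum regroups into pairs (2k + 2, 2k + 3),
     which share a bracket. *)
  rewrite big_split big_ord_recl (big_ord_recr _ (fun k : 'I_e.+1 => f k.+1.*2)) /=.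
  rewrite f1 f2 add0n addn0 -big_split /=.
  have -> : (2 * e * e.+1 = \sum_(k < e) 2 * e.+1)%N by rewrite sum_nat_const card_ord; lia.
  rewrite /B big_distrr -big_split; apply: eq_bigr => k _ /=.
  by rewrite (fmid true) // (fmid false) //; lia.
have BE e : (B e + 2 * e * e + 6 * e + 8 = 2 ^ e.+3)%N.
  elim: e => [|e IHe]; first by rewrite /B big_ord0.
  rewrite BS expnS -IHe; lia.
have -> : S3 d = S3upto d d.*2 by rewrite -mul2n.
rewrite szup -BE -/(B d). lia.
Qed.

Theorem proposition4p7 (d : nat) :
  increasing_enumeration (S3 d) (Div (Delta3 ^+ d)%g).
Proof.
split; first exact: uniq_S3.
  move=> x; split=> [|xd]; first exact: S3_Div.
  have inj := can_inj nfK.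
  have sub : {subset map nf (S3 d) <= nf_list d}.
    move=> _ /mapP[y /S3_Div yd ->]; apply: mem_nf_list (Div_nf_length yd).
    exact: Delta_free_nf.
  have uS : uniq (map nf (S3 d)) by rewrite (map_inj_uniq inj) uniq_S3.
  have szS : (size (nf_list d) <= size (map nf (S3 d)))%N.
    by rewrite size_map; move: (size_S3 d) (size_nf_list d); lia.
  (* A repetition-free list inside [nf_list d] that is at least as long has the same elements. *)
  have [_ E] := uniq_min_size uS sub szS.
  rewrite -(mem_map inj) E; apply: mem_nf_list (Div_nf_length xd).
  exact: Delta_free_nf.
move=> i j /andP[ij jd].
have /(pairwiseP 1)/(_ i j (ltn_trans ij jd) jd ij) := pairwise_S3upto d (2 * d).
by move/asboolP.
Qed.
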